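(* Let $R$ be a ring, $M$ a right $R$-module and $S=\mathrm{End}_R(M)$. If $M$ is a dual $\pi$-Rickart module, then $S$ is a generalized left principally projective ring.
   Context: Rings are associative with identity and modules are unitary right modules. $M$ is dual $\pi$-Rickart if for every $f\in S$ there exist $e^2=e\in S$ and a positive integer $n$ such that $\mathrm{Im} f^n=eM$. A ring $T$ is generalized left principally projective if for every $x\in T$ there is a positive integer $n$ such that the left annihilator $\{t\in T: tx^n=0\}$ of $x^n$ is generated, as a left ideal, by an idempotent of $T$. *)

(* Defs.v *)
From HB Require Import structures.
From mathcomp Require Import all_boot all_algebra.
From mathcomp Require Import boolp classical_sets.

Set Implicit Arguments.
Unset Strict Implicit.
Unset Printing Implicit Defensive.

Import GRing.Theory.
Local Open Scope classical_set_scope.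
Local Open Scope ring_scope.

(* A right R-module is a left module over the converse ring R^c: for a : R^c
   and m : M, a *: m stands for m a, and a *: (b *: m) = (b * a : R) *: m.
   Rings are pzRingType's, so the zero ring is allowed; in particular M may
   be the zero module, whose endomorphism ring is zero. *)

Section EndomorphismRing.
Variables (R : pzRingType) (M : lmodType R^c).

Record endo : Type := Endo { endo_linear :> {linear M -> M} }.

HB.instance Definition _ := gen_eqMixin endo.
HB.instance Definition _ := gen_choiceMixin endo.

Implicit Types f g h : endo.

Lemma endoP f g : f =1 g -> f = g.
Proof.
case: f g => [[f [[f1] [f2]]]] [[g [[g1] [g2]]]] /= /funext E.
case: _ / E in g1 g2 *.
by rewrite (Prop_irrelevance f1 g1) (Prop_irrelevance f2 g2).
Qed.

Definition endo_zero : endo := Endo \0.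
Definition endo_one : endo := Endo idfun.
Definition endo_opp f : endo := Endo (\- f).
Definition endo_add f g : endo := Endo (f \+ g).
Definition endo_mul f g : endo := Endo (f \o g).

Fact endo_addA : associative endo_add.
Proof. by move=> f g h; apply: endoP => x; apply: addrA. Qed.

Fact endo_addC : commutative endo_add.
Proof. by move=> f g; apply: endoP => x; apply: addrC. Qed.

Fact endo_add0 : left_id endo_zero endo_add.
Proof. by move=> f; apply: endoP => x; apply: add0r. Qed.

Fact endo_addN : left_inverse endo_zero endo_opp endo_add.
Proof. by move=> f; apply: endoP => x; apply: addNr. Qed.

HB.instance Definition _ :=
  GRing.isZmodule.Build endo endo_addA endo_addC endo_add0 endo_addN.

Fact endo_mulA : associative endo_mul.
Proof. by move=> f g h; apply: endoP. Qed.

Fact endo_mul1l : left_id endo_one endo_mul.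
Proof. by move=> f; apply: endoP. Qed.

Fact endo_mul1r : right_id endo_one endo_mul.
Proof. by move=> f; apply: endoP. Qed.

Fact endo_mulDl : left_distributive endo_mul +%R.
Proof. by move=> f g h; apply: endoP. Qed.

Fact endo_mulDr : right_distributive endo_mul +%R.
Proof.
by move=> f g h; apply: endoP => x; apply: linearD.
Qed.

HB.instance Definition _ := GRing.Zmodule_isPzRing.Build endo
  endo_mulA endo_mul1l endo_mul1r endo_mulDl endo_mulDr.

Lemma endo0E x : (0 : endo) x = 0. Proof. by []. Qed.
Lemma endo1E x : (1 : endo) x = x. Proof. by []. Qed.
Lemma endoNE f x : (- f) x = - f x. Proof. by []. Qed.
Lemma endoDE f g x : (f + g) x = f x + g x. Proof. by []. Qed.
Lemma endoME f g x : (f * g) x = f (g x). Proof. by []. Qed.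

Definition dual_pi_Rickart : Prop :=
  forall f : endo, exists (e : endo) (n : nat),
    [/\ e * e = e, (0 < n)%N & range (f ^+ n) = range e].

End EndomorphismRing.

Section GeneralizedLeftPP.
Variable T : pzRingType.

(* Closure under opposites follows from multiplication by -1. *)
Definition left_ideal (I : set T) : Prop :=
  [/\ I 0, forall x y, I x -> I y -> I (x + y) & forall t x, I x -> I (t * x)].

Definition left_ideal_gen (A : set T) : set T := smallest left_ideal A.

Definition left_annihilator (x : T) : set T := [set t | t * x = 0].

Definition generalized_left_pp : Prop :=
  forall x : T, exists (n : nat) (e : T),
    [/\ (0 < n)%N, e * e = e &
        left_annihilator (x ^+ n) = left_ideal_gen [set e]].

Lemma left_ideal_gen1 (a : T) : left_ideal_gen [set a] = range ( *%R^~ a).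
Proof.
apply/seteqP; split=> x.
  apply; split; last by move=> _ ->; exists 1; rewrite ?mul1r.
  split; first by exists 0; rewrite ?mul0r.
    by move=> _ _ [s _ <-] [t _ <-]; exists (s + t); rewrite ?mulrDl.
  by move=> t _ [s _ <-]; exists (t * s); rewrite ?mulrA.
by move=> [s _ <-] I [[_ _ IM] Ia]; apply/IM/Ia.
Qed.

End GeneralizedLeftPP.

(* Main.v *)
Require Import Defs.
From mathcomp Require Import all_boot all_algebra.
From mathcomp Require Import boolp classical_sets.
Local Open Scope ring_scope.
Import GRing.Theory.

(** Whether [t * f = 0] depends on [f] only through its image ([endo_mul_eq0]). So [f ^+ n] and an
    idempotent [e] with the same image have the same left annihilator, and that of [e] is generated
    by the idempotent [1 - e] ([left_annihilator_idem]). *)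

Lemma endo_mul_eq0 (R : pzRingType) (M : lmodType R^c) (t f : endo M) :
  t * f = 0 <-> (forall y, range f y -> t y = 0).
Proof.
split=> [tf0 _ [x _ <-]|tf0]; first by rewrite -endoME tf0.
by apply: endoP => x; rewrite endoME; apply: tf0; exists x.
Qed.

(** If [t * e = 0] then [t = t * (1 - e)]; conversely, [(1 - e) * e = 0]. *)
Lemma left_annihilator_idem (T : pzRingType) (e : T) : e * e = e ->
  left_annihilator e = left_ideal_gen [set 1 - e]%classic.
Proof.
move=> ee; rewrite left_ideal_gen1; apply/seteqP; split=> t /=.
  by move=> te0; exists t; rewrite // mulrBr mulr1 te0 subr0.
by case=> s _ <-; rewrite /left_annihilator /= -mulrA mulrBl mul1r ee subrr mulr0.
Qed.

Theorem lemma3p1 (R : pzRingType) (M : lmodType R^c) :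
  dual_pi_Rickart M -> generalized_left_pp (endo M).
Proof.
move=> Mrick f; have [e [n [ee n_gt0 fne]]] := Mrick f.
exists n, (1 - e); split=> //.
  by rewrite mulrBl mul1r mulrBr mulr1 ee subrr subr0.
rewrite -left_annihilator_idem //; apply/seteqP.
(* Both memberships become vanishing of [t] on a range, and [fne] equates the two ranges. *)
by split=> t /endo_mul_eq0 t0; apply/endo_mul_eq0; move: t0; rewrite fne.
Qed.
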